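(* There exists a universal constant $C>0$ such that the following holds. Let $V$ be a finite set with $|V|=n$, let $P$ be an irreducible transition matrix on $V$ with stationary distribution $\pi$, let $p\in(0,1]$, and consider the noisy voter model $\mathrm{NVM}(V,P,p)$ with stationary distribution $\Gamma$. Let $\xi\sim\Gamma$, $S=\sum_{x\in V}\pi(x)\xi(x)$, $\sigma^2=\mathrm{Var}(S)$, $\pi^*=\max_{x\in V}\pi(x)$, $\nu^2=\sum_{x\in V}\pi(x)^2$, $\mu(x,y)=\pi(x)^2P(x,y)/\nu^2$ and $$\Psi:=\sum_{x\in V}\sum_{y\in V}\mu(x,y)\mathbf 1_{\{\xi(x)\neq\xi(y)\}}.$$ Let $\Phi$ be the cumulative distribution function of a standard Gaussian random variable on $\mathbb R$. Then $$\sup_{t\in\mathbb R}\Big|\mathbb P\Big(\frac{S-1/2}{\sigma}\le t\Big)-\Phi(t)\Big|\le C\Big\{\Big(\frac{\pi^*}{\sigma}\Big)^3\frac np+\Big(\frac{\pi^*}{\sigma}\Big)^2\sqrt{\frac np}+\frac{\nu^2}{p\sigma^2}\sqrt{\mathrm{Var}(\Psi)}\Big\}.$$ Moreover, $$\mathrm{Var}(\Psi)\le 16\,\sigma^2(\pi^* )^2\nu^{-4}.$$ In particular, if a sequence of noisy voter models $\mathrm{NVM}(V_n,P_n,p_n)$, $n\ge1$, with $|V_n|=n$, $P_n$ irreducible, $p_n\in(0,1]$ and $(p_n)$ non-increasing, satisfies $$\frac{n}{p_n}\Big(\frac{\pi_n^*}{\sigma_n}\Big)^3+\frac{\pi_n^*}{\sigma_np_n}\to0\quad\text{as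 }n\to\infty,$$ then $W_n:=\frac{S_n-\mathbb E(S_n)}{\sigma_n}$ converges in distribution to $N(0,1)$, where $\pi_n^*,S_n,\sigma_n$ are the quantities above for $\mathrm{NVM}(V_n,P_n,p_n)$.
   Context: Noisy voter model: let $V$ be a finite set, $n=|V|$, $P$ an irreducible transition (stochastic) matrix on $V$, and $p\in(0,1]$. $\mathrm{NVM}(V,P,p)$ is the discrete-time Markov chain on $\{0,1\}^V$ which at each step chooses a vertex $x\in V$ uniformly at random and updates only its opinion: with probability $p$ the opinion of $x$ is replaced by a fair coin flip in $\{0,1\}$; otherwise, with probability $1-p$, a vertex $y$ is chosen with probability $P(x,y)$ and the opinion of $x$ is replaced by the current opinion of $y$. For $p>0$ this chain is irreducible and aperiodic and $\Gamma$ denotes its unique stationary distribution. *)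

(* Defs.v *)
From HB Require Import structures.
From mathcomp Require Import all_boot all_order all_algebra.
From mathcomp Require Import all_classical all_reals all_analysis.

Set Implicit Arguments.
Unset Strict Implicit.
Unset Printing Implicit Defensive.

Import Order.TTheory GRing.Theory Num.Theory.
Import numFieldNormedType.Exports.

Local Open Scope classical_set_scope.
Local Open Scope ring_scope.

Section FiniteChains.
Context {R : realType} {T : finType}.

Definition is_distribution (m : T -> R) : Prop :=
  (forall x, 0 <= m x) /\ \sum_(x : T) m x = 1.

Definition is_stochastic (P : T -> T -> R) : Prop :=
  forall x, is_distribution (P x).

Fixpoint kernel_pow (P : T -> T -> R) (k : nat) (x y : T) : R :=
  if k is k'.+1 then \sum_(z : T) P x z * kernel_pow P k' z y
  else (x == y)%:R.

Definition is_irreducible (P : T -> T -> R) : Prop :=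
  forall x y, exists k, 0 < kernel_pow P k x y.

Definition is_stationary (P : T -> T -> R) (m : T -> R) : Prop :=
  is_distribution m /\ forall y, \sum_(x : T) m x * P x y = m y.

(* In the next four definitions, [m] is the law of a random element [w] of [T],
   and a random variable is a function [X] of [w]. *)
Definition fin_prob (m : T -> R) (A : pred T) : R := \sum_(w : T | A w) m w.

Definition fin_expect (m : T -> R) (X : T -> R) : R := \sum_(w : T) m w * X w.

Definition fin_var (m : T -> R) (X : T -> R) : R :=
  fin_expect m (fun w => (X w - fin_expect m X) ^+ 2).

Definition fin_cdf (m : T -> R) (X : T -> R) (t : R) : R :=
  fin_prob m (fun w => X w <= t).

End FiniteChains.

(* [F n] and [G] are the cumulative distribution functions of the random
   variables, which may live on different probability spaces. *)
Definition cvg_in_distribution {R : realType} (F : nat -> R -> R) (G : R -> R)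
  : Prop :=
  forall t, {for t, continuous G} -> F n t @[n --> \oo] --> G t.

Definition gaussian_cdf {R : realType} (t : R) : R :=
  fine (normal_prob 0 1 `]-oo, t]).

Section NoisyVoterModel.
Context {R : realType} {V : finType}.

Definition config := {ffun V -> bool}.

Definition update (eta : config) (x : V) (b : bool) : config :=
  [ffun z => if z == x then b else eta z].

(* Transition probability from [eta] to [eta']. *)
Definition NVM (P : V -> V -> R) (p : R) (eta eta' : config) : R :=
  \sum_(x : V) #|V|%:R^-1 *
    (p * (\sum_(b : bool) 2^-1 * (eta' == update eta x b)%:R)
     + (1 - p) * (\sum_(y : V) P x y * (eta' == update eta x (eta y))%:R)).

Definition opinion_mean (pi : V -> R) (xi : config) : R :=
  \sum_(x : V) pi x * (xi x)%:R.

Definition sigma (pi : V -> R) (Gam : config -> R) : R :=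
  Num.sqrt (fin_var Gam (opinion_mean pi)).

(* The default value 0 is harmless, as [pi] is nonnegative and [V] nonempty. *)
Definition pi_star (pi : V -> R) : R := \big[Num.max/0]_(x : V) pi x.

Definition nu2 (pi : V -> R) : R := \sum_(x : V) pi x ^+ 2.

Definition mu (P : V -> V -> R) (pi : V -> R) (x y : V) : R :=
  pi x ^+ 2 * P x y / nu2 pi.

Definition disagreement (P : V -> V -> R) (pi : V -> R) (xi : config) : R :=
  \sum_(x : V) \sum_(y : V) mu P pi x y * (xi x != xi y)%:R.

End NoisyVoterModel.

Arguments config V : clear implicits.

(* Main.v *)
Require Import Defs.
From HB Require Import structures.
From mathcomp Require Import all_boot all_order all_algebra.
From mathcomp Require Import all_classical all_reals all_analysis.
From mathcomp Require Import ring lra.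

Set Implicit Arguments.
Unset Strict Implicit.
Unset Printing Implicit Defensive.

Import Order.TTheory GRing.Theory Num.Theory.
Import numFieldNormedType.Exports.

Local Open Scope classical_set_scope.
Local Open Scope ring_scope.

(** Write lam := p / n, A := pi_star / sigma and W := (S - 1/2) / sigma. Since
[pi] is stationary for [P], one step of the chain from xi satisfies
E[S' - S | xi] = lam (1/2 - S), so W' - W has conditional mean - lam W, and
|W' - W| <= A because a single opinion changes. The chain is in general not reversible,
so (W, W') need not be exchangeable; Stein's method for exchangeable pairs is
nevertheless available because it only needs E[F(W') - F(W)] = 0, which holds
for every F by stationarity.

Normal approximation. Take for F an antiderivative of the solution f of Stein's
equation f'(w) - w f(w) = 1_{w <= t} - Phi(t). A second order expansion of F
gives
  lam E[f(W) W] = E[f'(W) v] / 2 + error,   v := E[(W' - W)^2 | xi],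
so that lam (P(W <= t) - Phi(t)) is E[f'(W) (lam - v / 2)] up to the error. As
E v = 2 lam and |f'| <= 2, the main part is at most the standard deviation of v
([stein_stationary_kernel]). The error is of order A^3 away from t
([stein_linearize], [stein_taylor]); f' jumps at t, and the contribution of
|W - t| <= A is controlled by applying the same identity E[F(W') - F(W)] = 0 to
a Huber function centred at t, a convex function which is quadratic near t and
has slope at most 2A: this yields E[v 1_{|W - t| <= A}] <= 4 A lam
([concentration]). Finally 2 lam = E v <= A^2, whence A lam <= A^3 / 2 and a
total bound 12 A^3 / lam + sd(v) / lam. The rate of the voter model is
  sigma^2 v = p nu2 / (2 n) + (1 - p) nu2 Psi / n   ([opinion_mean_rate]),
which turns sd(v) / lam into the term with the variance of Psi.

Variance of Psi. Give configurations the distance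
d(eta, xi) = sum of pi x over the vertices where they disagree. Two copies of
the chain updated with the same vertex, the same coin and the same neighbour
contract d by the factor 1 - lam on average ([NVM_contraction]): this is the
drift computation again. The conditional variance decomposition
Var f = E Var(f(xi') | xi) + Var(Q f), iterated along f, Q f, Q^2 f ..., bounds the
variance of an L-Lipschitz f by a geometric series whose terms are multiples of
L^2 E d(xi', xi)^2 = L^2 E (S' - S)^2 = 2 L^2 lam sigma^2 ([var_lipschitz]). As
Psi is Lipschitz with constant 2 pi_star / nu2 ([disagreement_lipschitz]), its
variance is at most 8 sigma^2 pi_star^2 / nu2^2.

Central limit theorem. This variance bound makes the last term of the normal
approximation at most 4 pi_star / (sigma p) ([fluctuation_term_le]), and both
remaining terms are then those assumed to vanish. *)

(** * The Gaussian distribution and Stein's equation *)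

Section Gaussian.
Context {R : realType}.
Implicit Types t w x z A B : R.
Local Notation Phi := (@gaussian_cdf R).
Local Notation phi := (normal_pdf (0 : R) 1).

Lemma gaussian_pdfE x : phi x = normal_peak 1 * expR (- x ^+ 2 / 2).
Proof.
by rewrite normal_pdfE ?oner_neq0// /normal_fun subr0 expr1n.
Qed.

Lemma gaussian_pdf_gt0 x : 0 < phi x.
Proof. by rewrite gaussian_pdfE mulr_gt0 ?expR_gt0// normal_peak_gt0 ?oner_neq0. Qed.

Lemma gaussian_pdfN x : phi (- x) = phi x.
Proof. by rewrite !gaussian_pdfE sqrrN. Qed.

Lemma is_derive_gaussian_pdf x : is_derive x 1 phi (- x * phi x).
Proof.
rewrite (_ : phi = fun y => normal_peak 1 * expR (- y ^+ 2 / 2)); last first.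
  by apply/funext => y; rewrite gaussian_pdfE.
apply: is_derive_eq.
by rewrite !scaler0 !scaler1 /GRing.scale/=; field.
Qed.

Lemma is_derive_gaussian_cdf x : is_derive x 1 Phi (phi x).
Proof.
have xx1 : x < x + 1 by rewrite ltrDl.
have iphi : lebesgue_measure.-integrable `]-oo, x + 1] (EFin \o phi).
  by apply: (integrableS measurableT) => //; exact: integrable_normal_pdf.
have cphi : {for x, continuous phi}.
  by apply: continuous_normal_pdf; exact: oner_neq0.
have [d <-] := continuous_FTC1 xx1 iphi (ltNyr _) cphi.
by rewrite derive1E; exact/derivableP.
Qed.

Lemma gaussian_cdf_ge0 t : 0 <= Phi t.
Proof. by apply: fine_ge0; apply: measure_ge0. Qed.

Lemma gaussian_cdf_le1 t : Phi t <= 1.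
Proof.
rewrite -[leRHS]/(fine 1%E) fine_le ?fin_num_measure//.
exact: probability_le1.
Qed.

Let idTR : measurableTypeR R -> R := idfun.

#[local] HB.instance Definition _ :=
  @isMeasurableFun.Build _ _ _ _ idTR (@measurable_id _ _ setT).

Lemma cvg_gaussian_cdf_y : Phi t @[t --> +oo] --> (1 : R).
Proof.
exact/fine_cvg/(@cvg_cdfy1 _ _ _ (normal_prob 0 1 : probability _ R) idTR).
Qed.

Lemma cvg_gaussian_cdf_Ny : Phi t @[t --> -oo] --> (0 : R).
Proof.
exact/fine_cvg/(@cvg_cdfNy0 _ _ _ (normal_prob 0 1 : probability _ R) idTR).
Qed.

Lemma gaussian_cdf_homo : {homo Phi : x y / x <= y}.
Proof.
move=> x y xy; rewrite fine_le ?fin_num_measure//.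
by rewrite le_measure ?inE//; exact: subitvPr.
Qed.

(** The derivative of Phi(t) + Phi(- t) vanishes, and this sum tends to 1. *)
Lemma gaussian_cdfN t : Phi (- t) = 1 - Phi t.
Proof.
pose H x : R := Phi x + Phi (- x).
have dH x : is_derive x 1 H 0.
  have d1 := is_derive_gaussian_cdf x.
  have d2 : is_derive x 1 (Phi \o -%R) (- phi x).
    have dPhi := is_derive_gaussian_cdf (- x).
    have dN : is_derive x 1 (-%R : R -> R) (-1) by apply: is_derive_eq.
    have := is_derive1_comp dPhi dN => /trigger_derive; apply.
    by rewrite gaussian_pdfN mulrN1.
  have := is_deriveD d1 d2.
  by rewrite subrr.
have HN : H @ +oo --> (1 + 0 : R).
  apply: cvgD; first exact: cvg_gaussian_cdf_y.
  exact: (iffLR (cvgNy_compNP Phi _) cvg_gaussian_cdf_Ny).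
have /(cvg_unique _ HN) : H @ +oo --> H t.
  rewrite (_ : H = cst (H t)); first exact: cvg_cst.
  by apply/funext => x; exact: is_derive_0_is_cst.
by rewrite addr0 /H => ->//; rewrite addrC addKr.
Qed.

Lemma mean_value (f df : R -> R) (a b : R) : a <= b ->
  (forall x, a <= x <= b -> is_derive x 1 f (df x)) ->
  exists2 c, a <= c <= b & f b - f a = df c * (b - a).
Proof.
move=> ab dfE; have [||c] := @MVT_segment R f df a b ab.
- move=> x; rewrite in_itv/= => /andP[ax xb].
  by apply: dfE; rewrite !ltW.
- apply: derivable_within_continuous => x; rewrite in_itv/= => xab.
  by have [] := dfE _ xab.
- by rewrite in_itv/= => cab ->; exists c.
Qed.

(** Mills' ratio; the solution of Stein's equation is built from it because it
solves [y' = w y - 1]. *)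
Definition mills w : R := (1 - Phi w) / phi w.

Lemma mills_ge0 w : 0 <= mills w.
Proof.
by rewrite divr_ge0 ?subr_ge0 ?gaussian_cdf_le1// ltW ?gaussian_pdf_gt0.
Qed.

Lemma is_derive_mills w : is_derive w 1 mills (w * mills w - 1).
Proof.
have p0 := gaussian_pdf_gt0 w; have pn0 : phi w != 0 by rewrite gt_eqF.
have d1 := is_derive_gaussian_cdf w.
have d2 := is_derive_gaussian_pdf w.
have d3 := is_deriveV pn0 d2.
have d4 : is_derive w 1 (fun x => 1 - Phi x) (- phi w).
  have := is_deriveB (is_derive_cst (1 : R) w 1) d1 => /trigger_derive; apply.
  by rewrite sub0r.
have := is_deriveM d4 d3; rewrite /mills => /trigger_derive; apply.
by rewrite /mills/= /GRing.scale/=; field.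
Qed.

(** The classical tail bound: for positive w the function Phi(x) + phi(x) / x
decreases on [w, +oo[ and tends to 1. *)
Lemma mulr_mills_le1 w : w * mills w <= 1.
Proof.
have [w0|w0] := leP w 0.
  by rewrite (le_trans _ ler01)// mulr_le0_ge0 ?mills_ge0.
rewrite /mills mulrA ler_pdivrMr ?gaussian_pdf_gt0// mul1r mulrC.
rewrite -ler_pdivlMr// lerBlDl.
pose h x := Phi x + phi x / x.
have hw b : w <= b -> Phi b <= h w.
  move=> wb; have b0 := lt_le_trans w0 wb.
  have dh x : w <= x <= b -> is_derive x 1 h (- phi x / x ^+ 2).
    move=> /andP[wx _]; have x0 : x != 0 by rewrite gt_eqF// (lt_le_trans w0).
    have d1 := is_derive_gaussian_cdf x.
    have d2 := is_derive_gaussian_pdf x.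
    have d3 := is_deriveV x0 (is_derive_id x 1).
    have := is_deriveD d1 (is_deriveM d2 d3) => /trigger_derive; apply.
    by rewrite /GRing.scale/=; field.
  have [c _ hE] := mean_value wb dh.
  have : h b <= h w.
    rewrite -subr_le0 hE mulr_le0_ge0 ?subr_ge0// mulNr oppr_le0.
    by rewrite divr_ge0 ?sqr_ge0// ltW ?gaussian_pdf_gt0.
  by apply: le_trans; rewrite lerDl divr_ge0 ?(ltW b0)// ltW ?gaussian_pdf_gt0.
rewrite -[X in X <= _](cvg_lim _ cvg_gaussian_cdf_y)//.
apply: limr_le; first by apply: cvgP; exact: cvg_gaussian_cdf_y.
by near=> b; apply: hw; near: b; apply: nbhs_pinfty_ge; exact: num_real.
Unshelve. all: by end_near. Qed.

Lemma mulr_mills_ge0 w : 0 <= w -> 0 <= w * mills w.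
Proof. by move=> w0; rewrite mulr_ge0 ?mills_ge0. Qed.

Lemma mills_nincr a b : a <= b -> mills b <= mills a.
Proof.
move=> ab; have [c _ cE] := mean_value ab (fun x _ => is_derive_mills x).
by rewrite -subr_le0 cE mulr_le0_ge0 ?subr_ge0// subr_le0 mulr_mills_le1.
Qed.

(** By monotonicity it suffices to look at 0, and the differential equation
bounds the decrease of Mills' ratio between 0 and 1 by 1. *)
Lemma mills_le2 w : 0 <= w -> mills w <= 2.
Proof.
move=> w0; apply: (le_trans (mills_nincr w0)).
have [c /andP[c0 _]] := mean_value ler01 (fun x _ => is_derive_mills x).
rewrite subr0 mulr1 => cE.
have := mulr_mills_le1 1; have := mulr_ge0 c0 (mills_ge0 c); lra.
Qed.

(** The two branches of the solution of Stein's equation agree at [w]. *)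
Lemma cdf_mills w : Phi w * mills w = Phi (- w) * mills (- w).
Proof.
by rewrite /mills gaussian_pdfN gaussian_cdfN; ring.
Qed.

(** The bounded solution f of Stein's equation
f'(w) - w f(w) = 1_{w <= z} - Phi(z). *)
Definition stein z w : R :=
  if z <= w then Phi z * mills w else Phi (- z) * mills (- w).

(** This symmetry reduces every property of [stein z] to the half-line
[z <= w]. *)
Lemma stein_opp z w : stein (- z) (- w) = stein z w.
Proof.
rewrite /stein lerN2 !opprK; case: ltgtP => // ->.
by rewrite -cdf_mills.
Qed.

Lemma stein_ge0 z w : 0 <= stein z w.
Proof. by rewrite /stein; case: ifP; rewrite mulr_ge0 ?gaussian_cdf_ge0 ?mills_ge0. Qed.

Lemma stein_bounds z w : stein z w <= 2 /\ `|w * stein z w| <= 1.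
Proof.
move: z w; suff H z w : z <= w -> stein z w <= 2 /\ `|w * stein z w| <= 1.
  move=> z w; have [/H//|/ltW] := leP z w.
  by rewrite -lerN2 => /H; rewrite stein_opp mulNr normrN.
move=> zw; rewrite /stein zw.
have [z0 z1] := (gaussian_cdf_ge0 z, gaussian_cdf_le1 z).
have [w0|w0] := leP 0 w.
  have zM0 := mulr_ge0 z0 (mills_ge0 w).
  rewrite (ger0_norm (mulr_ge0 w0 zM0)); split.
    by rewrite (le_trans _ (mills_le2 w0))// ler_piMl ?mills_ge0.
  by rewrite mulrCA (le_trans _ (mulr_mills_le1 w))// ler_piMl// mulr_mills_ge0.
(* For z <= w < 0, monotonicity of Phi and [cdf_mills] bring back the case of
   a positive argument. *)
have wz : Phi z * mills w <= mills (- w).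
  apply: (@le_trans _ _ (Phi w * mills w)).
    by rewrite ler_wpM2r ?mills_ge0// gaussian_cdf_homo.
  by rewrite cdf_mills ler_piMl ?mills_ge0 ?gaussian_cdf_le1.
have Nw0 : 0 <= - w by rewrite oppr_ge0 ltW.
split; first exact: (le_trans wz (mills_le2 Nw0)).
rewrite normrM ltr0_norm// (ger0_norm (mulr_ge0 z0 (mills_ge0 w))).
by rewrite (le_trans _ (mulr_mills_le1 (- w)))// ler_wpM2l.
Qed.

(** The derivative of [stein z], read off Stein's equation; at [w = z] it is the
left derivative. *)
Definition dstein z w : R := w * stein z w + (w <= z)%R%:R - Phi z.

Lemma dstein_le2 z w : `|dstein z w| <= 2.
Proof.
have [z0 z1] := (gaussian_cdf_ge0 z, gaussian_cdf_le1 z).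
have [_] := stein_bounds z w; rewrite /dstein !ler_norml.
by case: (w <= z) => /=; lra.
Qed.

(** Each branch of [stein z] is smooth on the whole line, so the mean value theorem
holds on either side of the kink up to [z] included; the branch on the left is
the mirror image of the one on the right. *)
Lemma stein_MVTr z a b : z <= a -> z <= b ->
  exists2 c, `|c - a| <= `|b - a| &
    stein z b - stein z a = (c * stein z c - Phi z) * (b - a).
Proof.
have H x y : z <= x -> x <= y -> exists2 c, x <= c <= y &
    stein z y - stein z x = (c * stein z c - Phi z) * (y - x).
  move=> zx xy.
  have [c /andP[xc cy] cE] := mean_value xy (fun x _ => is_derive_mills x).
  exists c; first exact/andP.
  by rewrite /stein zx (le_trans zx xy) (le_trans zx xc) -mulrBr cE; ring.
move=> za zb; have [ab|/ltW ba] := leP a b.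
  have [c /andP[ac cb] cE] := H _ _ za ab; exists c => //.
  by rewrite !ger0_norm ?subr_ge0// lerD2r.
have [c /andP[bc ca] cE] := H _ _ zb ba; exists c.
  by rewrite !ler0_norm ?subr_le0// lerN2 lerD2r.
by rewrite -opprB cE; ring.
Qed.

Lemma stein_MVTl z a b : a <= z -> b <= z ->
  exists2 c, `|c - a| <= `|b - a| &
    stein z b - stein z a = (c * stein z c + 1 - Phi z) * (b - a).
Proof.
rewrite -(lerN2 z a) -(lerN2 z b) => az bz.
have [c ca] := stein_MVTr az bz.
rewrite !stein_opp gaussian_cdfN -{2}(opprK c) stein_opp => cE.
exists (- c); last by rewrite cE; ring.
have -> : - c - a = - (c - - a) by ring.
have -> : b - a = - (- b - - a) by ring.
by rewrite !normrN.
Qed.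

Lemma stein_lipschitz z a b : `|stein z b - stein z a| <= 2 * `|b - a|.
Proof.
wlog ab : a b / a <= b.
  by move=> H; have [/H//|/ltW/H] := leP a b; rewrite distrC (distrC b).
have [z0 z1] := (gaussian_cdf_ge0 z, gaussian_cdf_le1 z).
have Hr x y : z <= x -> z <= y -> `|stein z y - stein z x| <= 2 * `|y - x|.
  move=> zx zy; have [c _ ->] := stein_MVTr zx zy.
  rewrite normrM ler_wpM2r//.
  have [_] := stein_bounds z c; rewrite !ler_norml; lra.
have Hl x y : x <= z -> y <= z -> `|stein z y - stein z x| <= 2 * `|y - x|.
  move=> xz yz; have [c _ ->] := stein_MVTl xz yz.
  rewrite normrM ler_wpM2r//.
  have [_] := stein_bounds z c; rewrite !ler_norml; lra.
have [za|/ltW az] := leP z a; first exact: Hr (le_trans za ab).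
have [bz|/ltW zb] := leP b z; first exact: Hl.
rewrite -(subrKA (stein z z)) (le_trans (ler_normD _ _))//.
have := Hr _ _ (lexx z) zb; have := Hl _ _ az (lexx z).
have -> : `|b - a| = `|b - z| + `|z - a|.
  by rewrite !(ger0_norm (x := _ - _)) ?subr_ge0//; ring.
lra.
Qed.

(** If [w] is farther than [A] from [z], the segment from [w] to [u] avoids the
kink, and on it the derivative c f(c) varies by at most
|c - w| |f(c)| + |w| |f(c) - f(w)|. Closer to [z] only the Lipschitz bound
remains, which costs the indicator term. *)
Lemma stein_linearize z A w u : `|u - w| <= A ->
  `|stein z u - stein z w - dstein z w * (u - w)| <=
  (2 * A * (1 + `|w|) + 4 * (`|w - z| <= A)%R%:R) * `|u - w|.
Proof.
move=> uwA; have A0 := le_trans (normr_ge0 _) uwA.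
have w0 := normr_ge0 w.
have [z0 z1] := (gaussian_cdf_ge0 z, gaussian_cdf_le1 z).
have [wzA|wzA] := boolP (`|w - z| <= A).
  rewrite (le_trans (ler_normB _ _))// (@le_trans _ _ (4 * `|u - w|))//; last first.
    by rewrite ler_wpM2r// mulr1 lerDr !mulr_ge0// addr_ge0.
  rewrite normrM.
  have := dstein_le2 z w => /ler_wpM2r-/(_ _ (normr_ge0 (u - w))).
  have := stein_lipschitz z w u; lra.
rewrite -ltNge in wzA; rewrite mulr0 addr0.
suff [c cA ->] : exists2 c, `|c - w| <= A & stein z u - stein z w
    = (dstein z w + (c * stein z c - w * stein z w)) * (u - w).
  rewrite -mulrBl normrM ler_wpM2r// addrAC subrr add0r.
  rewrite -(subrKA (w * stein z c)) -mulrBl -mulrBr (le_trans (ler_normD _ _))//.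
  rewrite !normrM (ger0_norm (stein_ge0 _ _)) mulrDr mulr1 lerD//.
    by have [c2 _] := stein_bounds z c; rewrite mulrC ler_pM// stein_ge0.
  rewrite [leRHS]mulrC ler_wpM2l// (le_trans (stein_lipschitz z w c))//.
  by rewrite ler_wpM2l.
move: (uwA) wzA; rewrite ler_norml => /andP[Auw uwA'].
have [zw|wz] := ltP z w => wzA.
- have zu : z <= u by move: wzA; rewrite ger0_norm; lra.
  have [c cE cS] := stein_MVTr (ltW zw) zu; exists c; first exact: le_trans uwA.
  by rewrite cS /dstein leNgt zw/=; ring.
- have uz : u <= z by move: wzA; rewrite ler0_norm; lra.
  have [c cE cS] := stein_MVTl wz uz; exists c; first exact: le_trans uwA.
  by rewrite cS /dstein wz/=; ring.
Qed.

Lemma continuous_stein z : continuous (stein z).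
Proof.
move=> w; apply/cvgrPdist_le => e e0; near=> x.
apply: (le_trans (stein_lipschitz z x w)).
rewrite mulrC -ler_pdivlMr//; near: x.
by apply: cvgr_dist_le; [exact: cvg_id|rewrite divr_gt0].
Unshelve. all: by end_near. Qed.

(** The integral from a fixed origin [B] is an antiderivative to the right of
[B], which is enough for functions evaluated at finitely many points. *)
Lemma antiderivative (f : R -> R) B : continuous f ->
  exists F : R -> R, forall x, B < x -> is_derive x 1 F (f x).
Proof.
move=> cf; exists (fun y => \int[lebesgue_measure]_(t in `[B, y]) f t).
move=> x Bx; have xx1 : x < x + 1 by rewrite ltrDl.
have intf : lebesgue_measure.-integrable `[B, x + 1] (EFin \o f).
  apply: continuous_compact_integrable; first exact: segment_compact.
  exact: continuous_subspaceT.
have [d <-] := continuous_FTC1_closed xx1 intf Bx (cf x).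
by rewrite derive1E; exact/derivableP.
Qed.

(** The second order remainder of F has derivative f u - f w - h (u - w), so the
mean value theorem turns a first order estimate for f into a second order one
for F, without a second derivative of F. *)
Lemma taylor2_le (F f : R -> R) (w w' h K : R) : 0 <= K ->
  (forall u, `|u - w| <= `|w' - w| -> is_derive u 1 F (f u)) ->
  (forall u, `|u - w| <= `|w' - w| ->
     `|f u - f w - h * (u - w)| <= K * `|u - w|) ->
  `|F w' - F w - f w * (w' - w) - h / 2 * (w' - w) ^+ 2| <= K * (w' - w) ^+ 2.
Proof.
move=> K0 dF fK.
pose G u := F u - f w * (u - w) - h / 2 * (u - w) ^+ 2.
have dG u : `|u - w| <= `|w' - w| ->
    is_derive u 1 G (f u - f w - h * (u - w)).
  move=> uw; have ? := dF u uw.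
  rewrite /G; apply: is_derive_eq.
  by rewrite /GRing.scale/=; field.
have [c cw ->] : exists2 c, `|c - w| <= `|w' - w| &
    F w' - F w - f w * (w' - w) - h / 2 * (w' - w) ^+ 2 =
    (f c - f w - h * (c - w)) * (w' - w).
  have [ww|/ltW ww] := leP w w'.
    have [|c /andP[wc cw] cE] :=
      mean_value ww (df := fun u => f u - f w - h * (u - w)) (f := G).
      move=> u /andP[wu uw]; apply: dG.
      by rewrite !ger0_norm ?subr_ge0// lerD2r.
    exists c; first by rewrite !ger0_norm ?subr_ge0// lerD2r.
    by rewrite -cE /G; ring.
  have [|c /andP[wc cw] cE] :=
    mean_value ww (df := fun u => f u - f w - h * (u - w)) (f := G).
    move=> u /andP[wu uw]; apply: dG.
    by rewrite !ler0_norm ?subr_le0// lerN2 lerD2r.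
  exists c; first by rewrite !ler0_norm ?subr_le0// lerN2 lerD2r.
  transitivity (- (G w - G w')); first by rewrite /G; ring.
  by rewrite cE; ring.
rewrite normrM -real_normK ?num_real// expr2 mulrA ler_wpM2r//.
by rewrite (le_trans (fK _ cw))// ler_wpM2l.
Qed.

(** The expansion of the test function F of Stein's method, an antiderivative of
[stein z]. *)
Lemma stein_taylor z B : exists F : R -> R, forall A w w',
  B < w - A -> `|w' - w| <= A ->
  `|F w' - F w - stein z w * (w' - w) - dstein z w / 2 * (w' - w) ^+ 2| <=
  (2 * A * (1 + `|w|) + 4 * (`|w - z| <= A)%R%:R) * (w' - w) ^+ 2.
Proof.
have [F dF] := @antiderivative _ B (@continuous_stein z).
exists F => A w w' Bw wA; apply: taylor2_le.
- by rewrite addr_ge0// !mulr_ge0// ?addr_ge0// (le_trans _ wA).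
- move=> u uw; apply: dF; rewrite (lt_le_trans Bw)//.
  have := le_trans uw wA; rewrite ler_norml; lra.
- by move=> u uw; apply: stein_linearize; exact: le_trans wA.
Qed.

End Gaussian.

(** * Expectation and variance on a finite probability space *)

Section Expectation.
Context {R : realType} {T : finType} (m : T -> R).
Implicit Types X Y : T -> R.
Local Notation E := (fin_expect m).

Lemma eq_expect X Y : X =1 Y -> E X = E Y.
Proof. by move=> XY; apply: eq_bigr => w _; rewrite XY. Qed.

Lemma expectD X Y : E (fun w => X w + Y w) = E X + E Y.
Proof. by rewrite -big_split/=; apply: eq_bigr => w _; rewrite mulrDr. Qed.

Lemma expectZ c X : E (fun w => c * X w) = c * E X.
Proof. by rewrite /fin_expect mulr_sumr; apply: eq_bigr => w _; rewrite mulrCA. Qed.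

Lemma expectN X : E (fun w => - X w) = - E X.
Proof. by rewrite /fin_expect -sumrN; apply: eq_bigr => w _; rewrite mulrN. Qed.

Lemma expectB X Y : E (fun w => X w - Y w) = E X - E Y.
Proof. by rewrite expectD expectN. Qed.

Hypothesis hm : is_distribution m.

Lemma expect_cst c : E (fun=> c) = c.
Proof. by rewrite /fin_expect -mulr_suml hm.2 mul1r. Qed.

Lemma ler_expect X Y : (forall w, m w != 0 -> X w <= Y w) -> E X <= E Y.
Proof.
move=> XY; apply: ler_sum => w _; have [->|mw] := eqVneq (m w) 0.
  by rewrite !mul0r.
by rewrite ler_wpM2l ?hm.1// XY.
Qed.

Lemma expect_ge0 X : (forall w, 0 <= X w) -> 0 <= E X.
Proof. by move=> X0; apply: sumr_ge0 => w _; rewrite mulr_ge0 ?hm.1. Qed.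

Lemma ler_norm_expect X : `|E X| <= E (fun w => `|X w|).
Proof.
rewrite (le_trans (ler_norm_sum _ _ _))//; apply: ler_sum => w _.
by rewrite normrM ger0_norm ?hm.1.
Qed.

Lemma varE X : fin_var m X = E (fun w => X w ^+ 2) - E X ^+ 2.
Proof.
rewrite /fin_var; set e := E X.
rewrite (@eq_expect _ (fun w => X w ^+ 2 + (- (2 * e) * X w + e ^+ 2))); last first.
  by move=> w; ring.
by rewrite expectD expectD expectZ expect_cst -/e; ring.
Qed.

Lemma var_ge0 X : 0 <= fin_var m X.
Proof. by apply: expect_ge0 => w; exact: sqr_ge0. Qed.

Lemma sqr_expect_le X : E X ^+ 2 <= E (fun w => X w ^+ 2).
Proof. by rewrite -subr_ge0 -varE var_ge0. Qed.

Lemma expect_norm_le X : E (fun w => `|X w|) <= Num.sqrt (E (fun w => X w ^+ 2)).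
Proof.
rewrite (le_trans (ler_norm _))// -sqrtr_sqr ler_wsqrtr//.
rewrite (le_trans (sqr_expect_le _))// le_eqVlt; apply/orP; left; apply/eqP.
by apply: eq_expect => w; rewrite real_normK ?num_real.
Qed.

Lemma varD X c : fin_var m (fun w => X w + c) = fin_var m X.
Proof.
rewrite /fin_var expectD expect_cst; apply: eq_expect => w.
by congr (_ ^+ 2); ring.
Qed.

Lemma varZ X c : fin_var m (fun w => c * X w) = c ^+ 2 * fin_var m X.
Proof.
by rewrite /fin_var expectZ -[RHS]expectZ; apply: eq_expect => w; ring.
Qed.

Lemma fin_cdfE X t : fin_cdf m X t = E (fun w => (X w <= t)%R%:R).
Proof.
rewrite /fin_cdf /fin_prob big_mkcond; apply: eq_bigr => w _.
by case: (X w <= t); rewrite ?mulr1 ?mulr0.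
Qed.

End Expectation.

Arguments eq_expect {R T m X} Y _.

(** * Huber's function *)

Section Huber.
Context {R : realType}.
Implicit Types c s v : R.

(** The derivative of Huber's function. *)
Definition clip c v : R := Num.max (- c) (Num.min c v).
(** Huber's function v^2 / 2 for |v| <= c and c |v| - c^2 / 2 elsewhere, written
so that it visibly is the value at s = clip c v of s v - s^2 / 2. *)
Definition huber c v : R := clip c v * v - clip c v ^+ 2 / 2.

Lemma clip_le c v : 0 <= c -> `|clip c v| <= c.
Proof.
move=> c0; rewrite /clip /Num.max /Num.min ler_norml.
by case: (ltP c v) => H1; case: ltP => H2; apply/andP; split; lra.
Qed.

(** Huber's function is the supremum of these affine functions of [v], the
Legendre transform of s^2 / 2 on [- c, c]; convexity follows. *)
Lemma huber_sup c s v : `|s| <= c -> s * v - s ^+ 2 / 2 <= huber c v.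
Proof.
rewrite ler_norml => /andP[cs sc]; have c0 : 0 <= c by lra.
have [sc0 cs0] : 0 <= c - s /\ 0 <= s + c by split; lra.
have := sqr_ge0 (c - s); have := sqr_ge0 (c + s); have := sqr_ge0 (v - s).
rewrite /huber /clip; have [cv|vc] := ltP c v.
  have vc0 : 0 <= v - c by lra.
  rewrite max_r; last by lra.
  by have := mulr_ge0 sc0 vc0; nra.
have [cv|cv] := leP (- c) v; first by nra.
have cv0 : 0 <= - c - v by lra.
by have := mulr_ge0 cs0 cv0; nra.
Qed.

Lemma huber_convex c v v' : 0 <= c -> 
  clip c v * (v' - v) <= huber c v' - huber c v.
Proof.
by move=> c0; have := huber_sup v' (clip_le v c0); rewrite [huber c v]/huber; lra.
Qed.

(** With threshold [2 * A], a step of size at most [A] starting within [A] of the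
origin stays in the quadratic region, where the expansion is exact; elsewhere
convexity gives nonnegativity. *)
Lemma huber_increment A v v' : `|v' - v| <= A ->
  (`|v| <= A)%R%:R * (v' - v) ^+ 2 / 2 <=
  huber (2 * A) v' - huber (2 * A) v - clip (2 * A) v * (v' - v).
Proof.
move=> vA; have A0 := le_trans (normr_ge0 _) vA.
have [v1|_] := boolP (`|v| <= A); last first.
  by rewrite !mul0r subr_ge0 huber_convex// mulr_ge0.
have small x : `|x| <= 2 * A -> clip (2 * A) x = x.
  rewrite ler_norml => /andP[x1 x2].
  by rewrite /clip min_r// max_r.
rewrite /huber !small.
  by rewrite le_eqVlt; apply/orP; left; apply/eqP; rewrite mul1r; field.
all: move: vA v1; rewrite !ler_norml; lra.
Qed.

End Huber.

(** * Normal approximation for a linear drift under a stationary kernel *)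

Section SteinKernel.
Context {R : realType} {T : finType} (Q : T -> T -> R) (m : T -> R).
Hypotheses (hQ : is_stochastic Q) (hm : is_stationary Q m).
Local Notation E := (fin_expect m).

Lemma stationary_expect (X : T -> R) : E (fun x => fin_expect (Q x) X) = E X.
Proof.
rewrite /fin_expect.
under eq_bigr do rewrite mulr_sumr.
rewrite exchange_big/=; apply: eq_bigr => y _.
by rewrite -[m y in RHS]hm.2 mulr_suml; apply: eq_bigr => x _; rewrite mulrA.
Qed.

Lemma stationary_increment (X : T -> R) :
  E (fun x => fin_expect (Q x) (fun y => X y - X x)) = 0.
Proof.
rewrite (eq_expect (fun x => fin_expect (Q x) X - X x)); last first.
  by move=> x; rewrite expectB expect_cst.
by rewrite expectB stationary_expect subrr.
Qed.

Variables (W : T -> R) (lam A : R).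
Hypotheses (lam0 : 0 < lam) (A0 : 0 <= A)
  (drift : forall x, fin_expect (Q x) (fun y => W y - W x) = - lam * W x)
  (jump : forall x y, Q x y != 0 -> `|W y - W x| <= A).

Let v x := fin_expect (Q x) (fun y => (W y - W x) ^+ 2).
Let hmd : is_distribution m := hm.1.

(** Stationarity applied to the function W^2. *)
Lemma expect_quadratic_rate : E v = 2 * lam * E (fun x => W x ^+ 2).
Proof.
have := stationary_increment (fun x => W x ^+ 2).
rewrite (eq_expect (fun x => v x + - (2 * lam) * W x ^+ 2)).
  by rewrite expectD expectZ => /eqP; rewrite mulNr subr_eq0 => /eqP.
move=> x; rewrite (eq_expect (fun y => (W y - W x) ^+ 2 + 2 * W x * (W y - W x))).
  by rewrite expectD expectZ drift /v; ring.
by move=> y; ring.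
Qed.

Lemma quadratic_rate_le x : v x <= A ^+ 2.
Proof.
rewrite -(expect_cst (hQ x) (A ^+ 2)); apply: (ler_expect (hQ x)) => y /jump WA.
by rewrite -(real_normK (num_real (W y - W x))) lerXn2r// nnegrE// (le_trans _ WA).
Qed.

Hypothesis W2 : E (fun x => W x ^+ 2) = 1.

Lemma rate_le_jump : 2 * lam <= A ^+ 2.
Proof.
have := expect_quadratic_rate; rewrite W2 mulr1 => <-; rewrite -(expect_cst hmd (A ^+ 2)).
by apply: (ler_expect hmd) => x _; exact: quadratic_rate_le.
Qed.

(** The identity at the heart of Stein's method: E[F(W') - F(W)] = 0 by
stationarity, and the drift turns the linear term into - lam E[f(W) W]. *)
Lemma stationary_linearization (F f h K : T -> R) :
  (forall x y, Q x y != 0 ->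
     `|F y - F x - f x * (W y - W x) - h x / 2 * (W y - W x) ^+ 2| <=
     K x * (W y - W x) ^+ 2) ->
  `|lam * E (fun x => f x * W x) - E (fun x => h x * v x) / 2| <=
  E (fun x => K x * v x).
Proof.
move=> FK.
have -> : lam * E (fun x => f x * W x) - E (fun x => h x * v x) / 2 =
  E (fun x => fin_expect (Q x) (fun y =>
     F y - F x - f x * (W y - W x) - h x / 2 * (W y - W x) ^+ 2)).
  rewrite [RHS](eq_expect (fun x => fin_expect (Q x) (fun y => F y - F x)
     + lam * (f x * W x) + - 2^-1 * (h x * v x))).
    by rewrite !expectD !expectZ stationary_increment; ring.
  by move=> x; rewrite !expectB !expectZ drift /v; field.
rewrite (le_trans (ler_norm_expect hmd _))//; apply: (ler_expect hmd) => x _.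
rewrite (le_trans (ler_norm_expect (hQ x) _))// -expectZ.
by apply: (ler_expect (hQ x)) => y; exact: FK.
Qed.

Lemma expect_norm_W : E (fun x => `|W x|) <= 1.
Proof. by rewrite (le_trans (expect_norm_le hmd _))// W2 sqrtr1. Qed.

(** Stationarity applied to Huber's function of W - z: the linear term is at most
lam E|f(W) W| <= 2 A lam as the slope f is bounded by 2 A, while the second
order term dominates half of the left-hand side. *)
Lemma concentration z :
  E (fun x => (`|W x - z| <= A)%R%:R * v x) <= 4 * A * lam.
Proof.
pose F x := huber (2 * A) (W x - z); pose f x := clip (2 * A) (W x - z).
have := stationary_increment F => E0.
have : E (fun x => (`|W x - z| <= A)%R%:R * v x / 2 - lam * (f x * W x)) <= 0.
  rewrite -[leRHS]E0; apply: (ler_expect hmd) => x _.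
  rewrite (_ : _ - _ = fin_expect (Q x) (fun y =>
     f x * (W y - W x) + (`|W x - z| <= A)%R%:R / 2 * (W y - W x) ^+ 2)).
    apply: (ler_expect (hQ x)) => y /jump WA.
    have := @huber_increment _ A (W x - z) (W y - z).
    have -> : W y - z - (W x - z) = W y - W x by ring.
    by move=> /(_ WA); rewrite /F /f; lra.
  by rewrite expectD !expectZ drift /v; ring.
have fW : E (fun x => f x * W x) <= 2 * A.
  have : E (fun x => f x * W x) <= E (fun x => 2 * A * `|W x|).
    apply: (ler_expect hmd) => x _.
    rewrite (le_trans (ler_norm _))// normrM ler_wpM2r// clip_le// mulr_ge0//.
  rewrite expectZ => /le_trans; apply.
  by rewrite ler_piMr ?mulr_ge0// expect_norm_W.
rewrite expectB expectZ.
rewrite (eq_expect (fun x => 2^-1 * ((`|W x - z| <= A)%R%:R * v x))); last first.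
  by move=> x; rewrite mulrC.
rewrite expectZ; have := ler_wpM2l (ltW lam0) fW; lra.
Qed.

(** The first term collects the remainder of the expansion, using 2 lam <= A^2 to
absorb the contribution A lam of the kink; the second is the fluctuation of the
quadratic rate [v] around its mean 2 lam, to which [dstein] contributes a factor
at most 2. *)
Theorem stein_stationary_kernel t :
  `|fin_cdf m W t - gaussian_cdf t| <=
  12 * A ^+ 3 / lam + Num.sqrt (fin_var m v) / lam.
Proof.
set K := E (fun x => dstein t (W x)).
(* All points within [A] of a value of [W] lie to the right of [B]. *)
pose B := - (\sum_x `|W x|) - A - 1.
have [F Ftaylor] := stein_taylor t B.
have BW x : B < W x - A.
  have : `|W x| <= \sum_x `|W x| by rewrite (bigD1 x)//= lerDl sumr_ge0.
  by rewrite /B ler_norml => /andP[]; lra.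
pose k x := 2 * A * (1 + `|W x|) + 4 * (`|W x - t| <= A)%R%:R.
have := @stationary_linearization (F \o W) (fun x => stein t (W x))
  (fun x => dstein t (W x)) k.
move=> /(_ (fun x y Qxy => Ftaylor A (W x) (W y) (BW x) (jump Qxy))).
have cdfE : fin_cdf m W t - gaussian_cdf t =
    E (fun x => dstein t (W x)) - E (fun x => stein t (W x) * W x).
  rewrite fin_cdfE -expectB [RHS](eq_expect (fun x => (W x <= t)%R%:R + - gaussian_cdf t)).
    by rewrite expectD expect_cst.
  by move=> x; rewrite /dstein; ring.
have A3 : 2 * lam * A <= A ^+ 3 by rewrite [leRHS]exprSr ler_wpM2r ?rate_le_jump.
have kv : E (fun x => k x * v x) <= 12 * A ^+ 3.
  apply: (@le_trans _ _ (2 * A * (2 * lam) + 2 * A * A ^+ 2 + 4 * (4 * A * lam))); last first.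
    by nra.
  apply: (@le_trans _ _ (E (fun x => 2 * A * v x + 2 * A * A ^+ 2 * `|W x| +
      4 * ((`|W x - t| <= A)%R%:R * v x)))).
    apply: (ler_expect hmd) => x _; rewrite /k.
    have := quadratic_rate_le x; have := normr_ge0 (W x).
    by move=> H1 H2; have := mulr_ge0 A0 (mulr_ge0 H1 (_ : 0 <= A ^+ 2 - v x)); nra.
  rewrite !expectD !expectZ expect_quadratic_rate W2 mulr1 !lerD// ?ler_wpM2l ?concentration//.
  by rewrite ler_piMr ?expect_norm_W// mulr_ge0 ?sqr_ge0// mulr_ge0.
have hv : `|lam * E (fun x => dstein t (W x)) - E (fun x => dstein t (W x) * v x) / 2|
    <= Num.sqrt (fin_var m v).
  rewrite -expectZ -[E _ / 2]mulrC -expectZ -expectB.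
  rewrite (le_trans (ler_norm_expect hmd _))//.
  apply: le_trans (expect_norm_le hmd _); apply: (ler_expect hmd) => x _.
  rewrite expect_quadratic_rate W2 mulr1.
  have -> : lam * dstein t (W x) - 2^-1 * (dstein t (W x) * v x) =
    (dstein t (W x) / 2) * - (v x - 2 * lam) by field.
  rewrite normrM normrN ler_piMl// normrM (ger0_norm (x := 2^-1)) ?invr_ge0//.
  by have := dstein_le2 t (W x); lra.
set e1 := E (fun x => dstein t (W x)) in hv cdfE *.
set e2 := E (fun x => stein t (W x) * W x) in cdfE *.
move=> H; rewrite -mulrDl ler_pdivlMr// -[X in _ * X](gtr0_norm lam0) -normrM cdfE.
have -> : (e1 - e2) * lam = (lam * e1 - E (fun x => dstein t (W x) * v x) / 2) -
  (lam * e2 - E (fun x => dstein t (W x) * v x) / 2) by ring.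
rewrite (le_trans (ler_normB _ _))// addrC lerD// (le_trans H)//.
Qed.

End SteinKernel.

(** * Variance of Lipschitz functions under a contracting kernel *)

Section Contraction.
Context {R : realType} {T : finType} (Q : T -> T -> R) (m : T -> R).
Hypotheses (hQ : is_stochastic Q) (hm : is_stationary Q m).
Local Notation E := (fin_expect m).
Implicit Types (f : T -> R) (L : R).

Lemma var_le_sqr (m' : T -> R) f c : is_distribution m' ->
  fin_var m' f <= fin_expect m' (fun y => (f y - c) ^+ 2).
Proof.
by move=> hm'; rewrite -(varD hm' f (- c)) (varE hm') gerBl sqr_ge0.
Qed.

Lemma total_variance f :
  fin_var m f = E (fun x => fin_var (Q x) f) +
    fin_var m (fun x => fin_expect (Q x) f).
Proof.
rewrite [LHS](varE hm.1) [X in _ = _ + X](varE hm.1).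
rewrite [X in _ = X + _](eq_expect (fun x => fin_expect (Q x) (fun y => f y ^+ 2) -
  fin_expect (Q x) f ^+ 2)); last first.
  by move=> x; rewrite (varE (hQ x)).
by rewrite expectB !(stationary_expect hm); ring.
Qed.

Variables (d : T -> T -> R) (D q s : R).
Hypotheses (q01 : 0 <= q < 1) (dD : forall x y, 0 <= d x y <= D).

Definition lipschitz_for L f := forall x y, `|f x - f y| <= L * d x y.

Hypothesis contract : forall L f, 0 <= L -> lipschitz_for L f ->
  lipschitz_for (q * L) (fun x => fin_expect (Q x) f).
Hypothesis step : E (fun x => fin_expect (Q x) (fun y => d y x ^+ 2)) <= s.

Lemma lipschitz_sqr L f x y : 0 <= L -> lipschitz_for L f ->
  (f x - f y) ^+ 2 <= L ^+ 2 * d x y ^+ 2.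
Proof.
move=> L0 fL; rewrite -exprMn -(real_normK (num_real (f x - f y))).
have /andP[d0 _] := dD x y.
by rewrite lerXn2r ?nnegrE ?mulr_ge0.
Qed.

(** [k] steps of the variance decomposition. In the induction step
q^2 s + (1 - q) s <= s, since q^2 <= q. *)
Lemma var_lipschitz_iter k : forall L f, 0 <= L -> lipschitz_for L f ->
  (1 - q) * fin_var m f <= L ^+ 2 * (s + D ^+ 2 * q ^+ k).
Proof.
case/andP: q01 => q0 q1.
have s0 : 0 <= s.
  by apply: le_trans step; apply: (expect_ge0 hm.1) => x;
    apply: (expect_ge0 (hQ x)) => y; exact: sqr_ge0.
elim: k => [|k IH] L f L0 fL.
  have /existsP[x0 _] : [exists x : T, true].
    apply/existsP; apply: contrapT => /forallNP noT.
    have := hm.1.2; rewrite big1; first by move/eqP; rewrite eq_sym oner_eq0.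
    by move=> x; have := noT x.
  have : fin_var m f <= L ^+ 2 * D ^+ 2.
    rewrite (le_trans (var_le_sqr f (f x0) hm.1))//.
    rewrite -(expect_cst hm.1 (L ^+ 2 * D ^+ 2)).
    apply: (ler_expect hm.1) => x _; rewrite (le_trans (lipschitz_sqr _ _ L0 fL))//.
    by have /andP[d0 dDx] := dD x x0; rewrite ler_wpM2l ?sqr_ge0// lerXn2r ?nnegrE// (le_trans d0).
  have := var_ge0 hm.1 f.
  have := mulr_ge0 (sqr_ge0 L) s0.
  rewrite expr0 mulr1; nra.
have := IH _ _ (mulr_ge0 q0 L0) (contract L0 fL).
have : E (fun x => fin_var (Q x) f) <= L ^+ 2 * s.
  apply: (@le_trans _ _ (L ^+ 2 * E (fun x => fin_expect (Q x) (fun y => d y x ^+ 2)))).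
    rewrite -expectZ; apply: (ler_expect hm.1) => x _.
    rewrite (le_trans (var_le_sqr f (f x) (hQ x)))// -expectZ.
    by apply: (ler_expect (hQ x)) => y _; exact: lipschitz_sqr.
  by rewrite ler_wpM2l ?sqr_ge0.
rewrite (total_variance f).
move: (E _) (fin_var m _) => a b aL bL.
have a1 : (1 - q) * a <= (1 - q) * (L ^+ 2 * s) by rewrite ler_wpM2l// subr_ge0 ltW.
rewrite [leLHS]mulrDr; apply: (le_trans (lerD a1 bL)).
have qq : q ^+ 2 <= q by rewrite expr2 ler_piMl// ltW.
have e1 : q ^+ 2 * (L ^+ 2 * s) <= q * (L ^+ 2 * s).
  by rewrite ler_wpM2r// mulr_ge0// sqr_ge0.
have e2 : q ^+ 2 * (L ^+ 2 * (D ^+ 2 * q ^+ k)) <= q * (L ^+ 2 * (D ^+ 2 * q ^+ k)).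
  by rewrite ler_wpM2r// mulr_ge0 ?sqr_ge0// mulr_ge0 ?sqr_ge0// exprn_ge0.
rewrite [q ^+ k.+1]exprS !exprMn; move: (q ^+ k) e2 => t e2; lra.
Qed.

(** The limit of the preceding bounds as the number of steps grows. *)
Lemma var_lipschitz L f : 0 <= L -> lipschitz_for L f ->
  (1 - q) * fin_var m f <= L ^+ 2 * s.
Proof.
move=> L0 fL; case/andP: (q01) => q0 q1.
have cv : (fun k => L ^+ 2 * (s + D ^+ 2 * q ^+ k)) @ \oo --> L ^+ 2 * (s + D ^+ 2 * 0).
  apply: cvgMr; apply: cvgD; first exact: cvg_cst.
  apply: cvgMr; apply: cvg_expr; rewrite ger0_norm//.
have := limr_ge (cvgP _ cv) (nearW _ (fun k => var_lipschitz_iter k L0 fL)).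
by rewrite (cvg_lim (@Rhausdorff R) cv) mulr0 addr0; apply.
Qed.

End Contraction.

(** * One step of the noisy voter model *)

Section NoisyVoter.
Context {R : realType} {V : finType} (P : V -> V -> R) (pi : V -> R) (p : R).
Hypotheses (hP : is_stochastic P) (hpi : is_stationary P pi) (p01 : 0 < p <= 1).
Local Notation n := (#|V|%:R : R).
Local Notation Q := (NVM P p).
Implicit Types (eta xi : config V) (f : config V -> R).

Lemma card_vertices_gt0 : 0 < n.
Proof.
rewrite ltr0n; apply/card_gt0P; apply: contrapT => /forallNP noV.
have := hpi.1.2; rewrite big1; first by move/eqP; rewrite eq_sym oner_eq0.
by move=> x; have := noV x.
Qed.

(** The average of [g x b] over the refreshed vertex [x] and its new opinion
[b]. *)
Definition mean_update eta (g : V -> bool -> R) : R :=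
  \sum_x n^-1 * (p * (\sum_(b : bool) 2^-1 * g x b) +
                 (1 - p) * fin_expect (P x) (fun y => g x (eta y))).

Lemma NVM_expect eta f :
  fin_expect (Q eta) f = mean_update eta (fun x b => f (update eta x b)).
Proof.
have pick (z : config V) : \sum_w (w == z)%:R * f w = f z.
  rewrite (bigD1 z)//= eqxx mul1r big1 ?addr0// => w /negPf ->.
  by rewrite mul0r.
rewrite /fin_expect /NVM.
under eq_bigr do rewrite mulr_suml.
rewrite exchange_big/=; apply: eq_bigr => x _.
under eq_bigr do rewrite -mulrA mulrDl -!mulrA.
rewrite -mulr_sumr big_split/=; congr (_ * (_ + _)).
  rewrite -mulr_sumr; congr (_ * _); under [LHS]eq_bigr do rewrite mulr_suml.
  rewrite exchange_big/=; apply: eq_bigr => b _.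
  by under [LHS]eq_bigr do rewrite -mulrA; rewrite -mulr_sumr pick.
rewrite -mulr_sumr; congr (_ * _); under [LHS]eq_bigr do rewrite mulr_suml.
rewrite exchange_big/=; apply: eq_bigr => y _.
by under [LHS]eq_bigr do rewrite -mulrA; rewrite -mulr_sumr pick.
Qed.

Lemma NVM_ge0 eta eta' : 0 <= Q eta eta'.
Proof.
have [p0 p1] := andP p01.
apply: sumr_ge0 => x _; rewrite mulr_ge0 ?invr_ge0//.
rewrite addr_ge0 ?mulr_ge0 ?subr_ge0 ?(ltW p0)//.
  by apply: sumr_ge0 => b _; rewrite mulr_ge0.
by apply: sumr_ge0 => y _; rewrite mulr_ge0 ?(hP x).1.
Qed.

Lemma mean_update_cst eta c : mean_update eta (fun _ _ => c) = c.
Proof.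
rewrite /mean_update; under eq_bigr do rewrite expect_cst// big_bool/=.
rewrite sumr_const -mulr_natl; have := card_vertices_gt0 => n0.
by field; rewrite gt_eqF.
Qed.

Lemma NVM_stochastic : is_stochastic Q.
Proof.
move=> eta; split; first exact: NVM_ge0.
transitivity (fin_expect (Q eta) (fun=> 1)).
  by apply: eq_bigr => w _; rewrite mulr1.
by rewrite NVM_expect mean_update_cst.
Qed.

Lemma NVM_update eta eta' : Q eta eta' != 0 -> exists x b, eta' = update eta x b.
Proof.
move=> Q0; apply: contrapT => /forallNP H; move/eqP: Q0; apply.
have H' x b : (eta' == update eta x b) = false.
  by apply/negP => /eqP E; apply: (H x); exists b.
rewrite /NVM big1// => x _; rewrite big1; last first.
  by move=> b _; rewrite H' mulr0.
by rewrite big1 ?mulr0 ?addr0 ?mulr0// => y _; rewrite H' mulr0.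
Qed.

Local Notation S := (opinion_mean pi).

Lemma opinion_mean_update eta x b :
  S (update eta x b) - S eta = pi x * (b%:R - (eta x)%:R).
Proof.
rewrite /opinion_mean -sumrB (bigD1 x)//= ffunE eqxx -mulrBr big1 ?addr0// => y.
by rewrite ffunE => /negPf ->; rewrite subrr.
Qed.

(** Copying a neighbour does not move S on average, as [pi] is stationary for
[P]; only the coin flips pull it towards 1/2. *)
Lemma opinion_mean_drift eta :
  fin_expect (Q eta) (fun eta' => S eta' - S eta) = p / n * (2^-1 - S eta).
Proof.
rewrite NVM_expect /mean_update.
have n0 : n != 0 by rewrite gt_eqF// card_vertices_gt0.
have piP : \sum_x pi x * (\sum_y P x y * (eta y)%:R) = S eta.
  under eq_bigr do rewrite mulr_sumr.
  rewrite exchange_big/=; apply: eq_bigr => y _.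
  by rewrite -[in RHS]hpi.2 mulr_suml; apply: eq_bigr => x _; rewrite mulrA.
transitivity (\sum_x (p / n * (pi x * 2^-1 - pi x * (eta x)%:R) + (1 - p) / n *
   (pi x * (\sum_y P x y * (eta y)%:R) - pi x * (eta x)%:R))).
  apply: eq_bigr => x _; rewrite big_bool/= !opinion_mean_update.
  under [X in (1 - p) * X]eq_expect => y do rewrite opinion_mean_update.
  rewrite expectZ expectB expect_cst// /fin_expect mulr1n mulr0n; field.
  by [].
rewrite big_split/= -!mulr_sumr !sumrB piP subrr mulr0 addr0.
by rewrite -mulr_suml hpi.1.2 mul1r.
Qed.

(** The coin changes the opinion of [x] with probability 1/2, copying changes it
when the chosen neighbour disagrees; a change at [x] moves S by [pi x]. *)
Lemma nu2_gt0 : 0 < nu2 pi.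
Proof.
have s0 : 0 <= nu2 pi by apply: sumr_ge0 => x _; exact: sqr_ge0.
rewrite lt_neqAle s0 andbT eq_sym; apply/negP => /eqP.
move=> /(psumr_eq0P (fun x _ => sqr_ge0 (pi x))) H.
have := hpi.1.2; rewrite big1; first by move/eqP; rewrite eq_sym oner_eq0.
by move=> x _; apply/eqP; rewrite -sqrf_eq0; apply/eqP/H.
Qed.

Lemma opinion_mean_rate eta :
  fin_expect (Q eta) (fun eta' => (S eta' - S eta) ^+ 2) =
  p / n * (nu2 pi / 2) + (1 - p) / n * (nu2 pi * disagreement P pi eta).
Proof.
have n0 : n != 0 by rewrite gt_eqF// card_vertices_gt0.
have v0 : nu2 pi != 0 by rewrite gt_eqF// nu2_gt0.
have sqrB (b c : bool) : (b%:R - c%:R) ^+ 2 = (b != c)%:R :> R.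
  by case: b c => [] []; rewrite /= ?subrr ?subr0 ?sub0r ?sqrrN ?expr0n ?expr1n.
have -> : nu2 pi * disagreement P pi eta =
    \sum_x pi x ^+ 2 * (\sum_y P x y * (eta x != eta y)%:R).
  rewrite /disagreement mulr_sumr; apply: eq_bigr => x _.
  rewrite !mulr_sumr; apply: eq_bigr => y _; rewrite /mu; field.
  by [].
rewrite NVM_expect /mean_update [X in p / n * (X / _)]/nu2 mulr_suml !mulr_sumr -big_split/=.
apply: eq_bigr => x _; rewrite big_bool/= !opinion_mean_update.
under [X in (1 - p) * X]eq_expect => y do
  rewrite opinion_mean_update exprMn sqrB eq_sym.
rewrite expectZ !exprMn !sqrB /fin_expect.
by case: (eta x) => /=; field.
Qed.

Definition weighted_dist eta xi : R := \sum_x pi x * (eta x != xi x)%:R.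

Lemma weighted_dist_bound eta xi : 0 <= weighted_dist eta xi <= 1.
Proof.
rewrite sumr_ge0/=; last by move=> x _; rewrite mulr_ge0 ?hpi.1.1.
rewrite -hpi.1.2; apply: ler_sum => x _.
by rewrite ler_piMr ?hpi.1.1//; case: (_ != _).
Qed.

Lemma weighted_dist_update eta xi x b c :
  weighted_dist (update eta x b) (update xi x c) =
  weighted_dist eta xi - pi x * (eta x != xi x)%:R + pi x * (b != c)%:R.
Proof.
rewrite /weighted_dist (bigD1 x)//= [in RHS](bigD1 x)//= !ffunE eqxx.
rewrite (eq_bigr (fun y => pi y * (eta y != xi y)%:R)); first by ring.
by move=> y /negPf yx; rewrite !ffunE yx.
Qed.

Lemma weighted_dist_step eta x b :
  weighted_dist (update eta x b) eta ^+ 2 = (S (update eta x b) - S eta) ^+ 2.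
Proof.
rewrite opinion_mean_update !exprMn /weighted_dist (bigD1 x)//= big1.
  rewrite addr0 ffunE eqxx exprMn; congr (_ * _).
  by case: b (eta x) => [] []; rewrite /= ?subrr ?subr0 ?sub0r ?sqrrN.
by move=> y /negPf yx; rewrite ffunE yx eqxx mulr0.
Qed.

(** Update both configurations at the same vertex, with the same coin or the same
neighbour. At the vertex [x] any disagreement is erased, and recreated when
[x] copies a neighbour at which the configurations disagree. Stationarity of
[pi] shows that copying preserves the distance on average, so the coin flips
alone produce the factor 1 - p / n. *)
Lemma NVM_contraction L f : 0 <= L -> lipschitz_for weighted_dist L f ->
  lipschitz_for weighted_dist ((1 - p / n) * L) (fun x => fin_expect (Q x) f).
Proof.
move=> L0 fL eta xi; rewrite !NVM_expect /mean_update -sumrB.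
have [p0 p1] := andP p01.
have n0 : n != 0 by rewrite gt_eqF// card_vertices_gt0.
have piP : \sum_x pi x * (\sum_y P x y * (eta y != xi y)%:R) = weighted_dist eta xi.
  under eq_bigr do rewrite mulr_sumr.
  rewrite exchange_big/=; apply: eq_bigr => y _.
  by rewrite -[in RHS]hpi.2 mulr_suml; apply: eq_bigr => x _; rewrite mulrA.
set w := weighted_dist eta xi in piP *.
apply: (@le_trans _ _ (\sum_x n^-1 * (p * (L * (w - pi x * (eta x != xi x)%:R)) +
   (1 - p) * (L * (w - pi x * (eta x != xi x)%:R +
      pi x * (\sum_y P x y * (eta y != xi y)%:R)))))).
  rewrite (le_trans (ler_norm_sum _ _ _))//; apply: ler_sum => x _.
  rewrite -mulrBr normrM ger0_norm ?invr_ge0// ler_wpM2l ?invr_ge0//.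
  rewrite opprD addrACA -!mulrBr (le_trans (ler_normD _ _))// !normrM.
  rewrite (gtr0_norm p0) (ger0_norm (x := 1 - p)) ?subr_ge0// lerD ?ler_wpM2l ?subr_ge0 ?(ltW p0)//.
    rewrite !big_bool/=.
    have := fL (update eta x true) (update xi x true).
    have := fL (update eta x false) (update xi x false).
    rewrite !weighted_dist_update/= mulr0 addr0 -/w !ler_norml; lra.
  rewrite -expectB (le_trans (ler_norm_expect (hP x) _))//.
  rewrite -/(fin_expect _ _) -expectZ.
  rewrite [leRHS](_ : _ = fin_expect (P x) (fun y =>
     L * (w - pi x * (eta x != xi x)%:R + pi x * (eta y != xi y)%:R))).
    by apply: (ler_expect (hP x)) => y _; rewrite (le_trans (fL _ _))// weighted_dist_update.
  by rewrite [RHS]expectZ expectD expectZ expect_cst.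
rewrite le_eqVlt; apply/orP; left; apply/eqP.
transitivity (\sum_x (n^-1 * L * w - L / n * (pi x * (eta x != xi x)%:R) +
   (1 - p) / n * L * (pi x * (\sum_y P x y * (eta y != xi y)%:R)))).
  by apply: eq_bigr => x _; field.
rewrite big_split sumrB/= -!mulr_sumr piP -/(weighted_dist eta xi) -/w sumr_const.
rewrite -[_ *+ _]mulr_natl; field.
by [].
Qed.

End NoisyVoter.

(** * The stationary noisy voter model *)

Lemma pi_star_ge0 {R : realType} {V : finType} (pi : V -> R) : 0 <= pi_star pi.
Proof. exact: bigmax_ge_id. Qed.

Section Stationary.
Context {R : realType} {V : finType} (P : V -> V -> R) (pi : V -> R) (p : R).
Variable Gam : config V -> R.
Hypotheses (hP : is_stochastic P) (hpi : is_stationary P pi) (p01 : 0 < p <= 1)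
  (hG : is_stationary (NVM P p) Gam).
Local Notation n := (#|V|%:R : R).
Local Notation Q := (NVM P p).
Local Notation S := (opinion_mean pi).
Local Notation s := (sigma pi Gam).
Local Notation Psi := (disagreement P pi).
Local Notation E := (fin_expect Gam).

Let n0 : 0 < n. Proof. exact: card_vertices_gt0 hpi. Qed.
Let v0 : 0 < nu2 pi. Proof. exact: nu2_gt0 hpi. Qed.
Let hQ : is_stochastic Q. Proof. exact: NVM_stochastic hP hpi p01. Qed.
Let star0 : 0 <= pi_star pi := pi_star_ge0 pi.
Let p0 : 0 < p. Proof. by case/andP: p01. Qed.
Let p1 : p <= 1. Proof. by case/andP: p01. Qed.

Lemma pi_le_star x : pi x <= pi_star pi.
Proof. by rewrite /pi_star; apply: le_bigmax. Qed.

Lemma rate_le1 : p / n <= 1.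
Proof.
rewrite ler_pdivrMr// mul1r (le_trans p1)// ler1n.
by rewrite -(ltr0n R).
Qed.

Lemma rate_gt0 : 0 < p / n. Proof. exact: divr_gt0. Qed.

(** A disagreement at [x] affects Psi through the first marginal of mu, which is
pi(x)^2 / nu2, and through the second one, which is at most
pi_star pi(x) / nu2 by stationarity of [pi]. *)
Lemma disagreement_lipschitz :
  lipschitz_for (weighted_dist pi) (2 * pi_star pi / nu2 pi) Psi.
Proof.
move=> eta xi; pose D x : R := (eta x != xi x)%:R.
have muE x y : mu P pi x y = (nu2 pi)^-1 * (pi x ^+ 2 * P x y).
  by rewrite /mu mulrC.
have mu0 x y : 0 <= mu P pi x y.
  by rewrite muE mulr_ge0 ?invr_ge0 ?(ltW v0)// mulr_ge0 ?sqr_ge0// (hP x).1.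
apply: (@le_trans _ _ (\sum_x \sum_y mu P pi x y * (D x + D y))).
  rewrite /disagreement -sumrB (le_trans (ler_norm_sum _ _ _))//.
  apply: ler_sum => x _; rewrite -sumrB (le_trans (ler_norm_sum _ _ _))//.
  apply: ler_sum => y _; rewrite -mulrBr normrM ger0_norm// ler_wpM2l// /D.
  by case: (eta x) (eta y) (xi x) (xi y) => [] [] [] []; rewrite /= ler_norml; lra.
under eq_bigr do (under eq_bigr do rewrite mulrDr; rewrite big_split/=).
rewrite big_split/= [X in _ + X]exchange_big/=.
rewrite (_ : 2 * pi_star pi / nu2 pi * _ =
  (nu2 pi)^-1 * (pi_star pi * weighted_dist pi eta xi) +
  (nu2 pi)^-1 * (pi_star pi * weighted_dist pi eta xi)); last by ring.
rewrite /weighted_dist !mulr_sumr; apply: lerD; apply: ler_sum => x _.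
  under eq_bigr do rewrite muE -!mulrA.
  rewrite -!mulr_sumr -mulr_suml (hP x).2 mul1r ler_wpM2l ?invr_ge0 ?(ltW v0)//.
  by rewrite ler_wpM2r ?pi_le_star// mulr_ge0 ?hpi.1.1.
under eq_bigr do rewrite muE -!mulrA.
rewrite -mulr_sumr ler_wpM2l ?invr_ge0 ?(ltW v0)//.
rewrite -[pi x in leRHS]hpi.2 mulr_suml mulr_sumr; apply: ler_sum => y _.
rewrite -[pi y * _ * _]mulrA ler_wpM2r ?pi_le_star// mulr_ge0 ?hpi.1.1//.
by rewrite mulr_ge0 ?(hP y).1.
Qed.

(** Under the stationary law the expected drift vanishes. *)
Lemma expect_opinion_mean : E S = 2^-1.
Proof.
have := stationary_increment hQ hG S.
under eq_expect do rewrite (opinion_mean_drift p hP hpi).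
rewrite expectZ expectB expect_cst; last exact: hG.1.
by move/eqP; rewrite mulf_eq0 gt_eqF ?rate_gt0//= subr_eq0 => /eqP.
Qed.

Lemma sigma_sqr : s ^+ 2 = E (fun xi => (S xi - 2^-1) ^+ 2).
Proof.
by rewrite /sigma (sqr_sqrtr (var_ge0 hG.1 _)) /fin_var expect_opinion_mean.
Qed.

Lemma centered_drift eta : fin_expect (Q eta)
  (fun eta' => (S eta' - 2^-1) - (S eta - 2^-1)) = - (p / n) * (S eta - 2^-1).
Proof.
rewrite (eq_expect (fun eta' => S eta' - S eta)); last by move=> y; ring.
by rewrite (opinion_mean_drift p hP hpi); ring.
Qed.

Lemma expect_opinion_mean_rate :
  E (fun xi => fin_expect (Q xi) (fun xi' => (S xi' - S xi) ^+ 2)) =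
  2 * (p / n) * s ^+ 2.
Proof.
rewrite sigma_sqr -(expect_quadratic_rate hQ hG centered_drift).
apply: eq_expect => x; apply: eq_expect => y; congr (_ ^+ 2); ring.
Qed.

(** Coin flips keep S moving, so its quadratic rate is positive. *)
Lemma sigma_gt0 : 0 < s.
Proof.
rewrite lt_neqAle sqrtr_ge0 andbT eq_sym; apply/negP => /eqP s0.
have := expect_opinion_mean_rate; rewrite s0 expr0n/= mulr0.
apply/eqP; rewrite gt_eqF//.
apply: (@lt_le_trans _ _ (E (fun=> p / n * (nu2 pi / 2)))).
  by rewrite (expect_cst hG.1) mulr_gt0 ?rate_gt0// divr_gt0.
apply: (ler_expect hG.1) => xi _; rewrite (opinion_mean_rate p hpi) lerDl.
rewrite mulr_ge0 ?divr_ge0 ?subr_ge0 ?(ltW n0)// mulr_ge0 ?(ltW v0)//.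
apply: sumr_ge0 => x _; apply: sumr_ge0 => y _; rewrite mulr_ge0//.
by rewrite /mu divr_ge0 ?(ltW v0)// mulr_ge0 ?sqr_ge0// (hP x).1.
Qed.

Lemma var_disagreement :
  fin_var Gam Psi <= 16 * s ^+ 2 * pi_star pi ^+ 2 / nu2 pi ^+ 2.
Proof.
have L0 : 0 <= 2 * pi_star pi / nu2 pi by rewrite divr_ge0 ?mulr_ge0 ?(ltW v0).
have q01 : 0 <= 1 - p / n < 1.
  by rewrite subr_ge0 rate_le1/= ltrBlDl ltrDr rate_gt0.
have step : E (fun x => fin_expect (Q x) (fun y => weighted_dist pi y x ^+ 2)) <=
    2 * (p / n) * s ^+ 2.
  rewrite -expect_opinion_mean_rate; apply: (ler_expect hG.1) => x _.
  apply: (ler_expect (hQ x)) => y /NVM_update[z [b ->]].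
  by rewrite weighted_dist_step.
have := var_lipschitz hQ hG q01 (weighted_dist_bound hpi)
  (NVM_contraction hP hpi p01) step L0 disagreement_lipschitz.
rewrite opprB addrC subrK.
rewrite (_ : _ ^+ 2 * _ = p / n * (8 * s ^+ 2 * pi_star pi ^+ 2 / nu2 pi ^+ 2)); last first.
  by field; rewrite !gt_eqF.
rewrite ler_pM2l ?rate_gt0// => /le_trans; apply.
rewrite ler_wpM2r ?invr_ge0 ?sqr_ge0// ler_wpM2r ?sqr_ge0// ler_wpM2r ?sqr_ge0//.
by rewrite ler_nat.
Qed.

Lemma opinion_mean_kolmogorov t :
  `|fin_cdf Gam (fun xi => (S xi - 2^-1) / s) t - gaussian_cdf t| <=
  12 * ((pi_star pi / s) ^+ 3 * (n / p) +
        nu2 pi / (p * s ^+ 2) * Num.sqrt (fin_var Gam Psi)).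
Proof.
have s0 := sigma_gt0.
pose W xi := (S xi - 2^-1) / s.
have WB x y : W y - W x = s^-1 * (S y - S x) by rewrite /W; ring.
have drift x : fin_expect (Q x) (fun y => W y - W x) = - (p / n) * W x.
  under eq_expect do rewrite WB.
  by rewrite expectZ (opinion_mean_drift p hP hpi) /W; ring.
have jump x y : Q x y != 0 -> `|W y - W x| <= pi_star pi / s.
  move=> /NVM_update[z [b ->]]; rewrite WB opinion_mean_update.
  rewrite normrM ger0_norm ?invr_ge0 ?(ltW s0)// mulrC ler_wpM2r ?invr_ge0 ?(ltW s0)//.
  rewrite normrM ger0_norm ?hpi.1.1// (le_trans _ (pi_le_star z))//.
  rewrite ler_piMr ?hpi.1.1//.
  by case: b (x z) => [] []; rewrite /= ler_norml; lra.
have W2 : E (fun x => W x ^+ 2) = 1.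
  rewrite (eq_expect (fun x => (s ^+ 2)^-1 * (S x - 2^-1) ^+ 2)); last first.
    by move=> x; rewrite /W exprMn exprVn mulrC.
  by rewrite expectZ -sigma_sqr mulVf// sqrf_eq0 gt_eqF.
have A0 : 0 <= pi_star pi / s by rewrite divr_ge0 ?(ltW s0).
have := stein_stationary_kernel hQ hG rate_gt0 A0 drift jump W2 t.
pose c := (s ^+ 2)^-1 * ((1 - p) / n * nu2 pi).
have -> : fin_var Gam (fun x => fin_expect (Q x) (fun y => (W y - W x) ^+ 2)) =
    c ^+ 2 * fin_var Gam Psi.
  rewrite -varZ -[RHS](varD hG.1 _ ((s ^+ 2)^-1 * (p / n * (nu2 pi / 2)))).
  congr (fin_var _ _); apply/funext => x.
  under eq_expect do rewrite WB exprMn exprVn.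
  by rewrite expectZ (opinion_mean_rate p hpi) /c; ring.
have c0 : 0 <= c.
  rewrite mulr_ge0 ?invr_ge0 ?sqr_ge0// mulr_ge0 ?(ltW v0)//.
  by rewrite divr_ge0 ?subr_ge0 ?(ltW n0).
rewrite (sqrtrM _ (sqr_ge0 c)) sqrtr_sqr (ger0_norm c0) => /le_trans; apply.
set r := Num.sqrt _; have r0 : 0 <= r by exact: sqrtr_ge0.
have -> : c * r / (p / n) = (1 - p) * (nu2 pi / (p * s ^+ 2) * r).
  by rewrite /c; field; rewrite !gt_eqF.
have -> : 12 * (pi_star pi / s) ^+ 3 / (p / n) = 12 * ((pi_star pi / s) ^+ 3 * (n / p)).
  by field; rewrite !gt_eqF.
have : 0 <= nu2 pi / (p * s ^+ 2) * r.
  by rewrite mulr_ge0// divr_ge0 ?(ltW v0)// mulr_ge0 ?sqr_ge0// ltW.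
by move: p0; nra.
Qed.

(** The variance bound makes [nu2] disappear from the last term. *)
Lemma fluctuation_term_le :
  nu2 pi / (p * s ^+ 2) * Num.sqrt (fin_var Gam Psi) <= 4 * (pi_star pi / (s * p)).
Proof.
have s0 := sigma_gt0.
have r4 : Num.sqrt (fin_var Gam Psi) <= 4 * s * pi_star pi / nu2 pi.
  have k0 : 0 <= 4 * s * pi_star pi / nu2 pi.
    by rewrite divr_ge0 ?(ltW v0)// mulr_ge0// mulr_ge0// ltW.
  rewrite -(ger0_norm k0) -sqrtr_sqr ler_wsqrtr// (le_trans var_disagreement)//.
  by rewrite le_eqVlt; apply/orP; left; apply/eqP; field; rewrite gt_eqF.
have k0 : 0 <= nu2 pi / (p * s ^+ 2).
  by rewrite divr_ge0 ?(ltW v0)// mulr_ge0 ?sqr_ge0// ltW.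
rewrite (le_trans (ler_wpM2l k0 r4))// le_eqVlt; apply/orP; left; apply/eqP.
by field; rewrite !gt_eqF.
Qed.

End Stationary.

Theorem theorem1 (R : realType) :
  exists C : R,
    0 < C /\
    (forall (V : finType) (P : V -> V -> R) (pi : V -> R) (p : R)
            (Gam : config V -> R),
       is_stochastic P -> is_irreducible P -> is_stationary P pi ->
       0 < p <= 1 -> is_stationary (NVM P p) Gam ->
       let n : R := #|V|%:R in
       let S := opinion_mean pi in
       let s := sigma pi Gam in
       let Psi := disagreement P pi in
       (ereal_sup
          (range (fun t : R =>
             `|fin_cdf Gam (fun xi => (S xi - 2^-1) / s) t - gaussian_cdf t|%:E))
        <= (C * ((pi_star pi / s) ^+ 3 * (n / p)
                 + (pi_star pi / s) ^+ 2 * Num.sqrt (n / p)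
                 + nu2 pi / (p * s ^+ 2) * Num.sqrt (fin_var Gam Psi)))%:E)%E
       /\ fin_var Gam Psi <= 16 * s ^+ 2 * pi_star pi ^+ 2 / nu2 pi ^+ 2)
    /\
    (forall (V : nat -> finType) (P : forall n, V n -> V n -> R)
            (pi : forall n, V n -> R) (p : nat -> R)
            (Gam : forall n, config (V n) -> R),
       (forall n, (1 <= n)%N -> #|V n| = n) ->
       (forall n, (1 <= n)%N ->
          [/\ is_stochastic (P n), is_irreducible (P n),
              is_stationary (P n) (pi n), 0 < p n <= 1
            & is_stationary (NVM (P n) (p n)) (Gam n)]) ->
       (forall m n, (1 <= m)%N -> (m <= n)%N -> p n <= p m) ->
       let S n := opinion_mean (pi n) in
       let s n := sigma (pi n) (Gam n) in
       (fun n => n%:R / p n * (pi_star (pi n) / s n) ^+ 3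
                 + pi_star (pi n) / (s n * p n)) @ \oo --> 0 ->
       cvg_in_distribution
         (fun n => fin_cdf (Gam n) (fun xi => (S n xi - fin_expect (Gam n) (S n)) / s n))
         gaussian_cdf).
Proof.
exists 12; split=> //; split.
  move=> V P pi p Gam hP _ hpi p01 hG n S s Psi; split; last first.
    exact: var_disagreement hP hpi p01 hG.
  apply: ge_ereal_sup => _ [t _ <-]; rewrite lee_fin.
  apply: (le_trans (opinion_mean_kolmogorov hP hpi p01 hG t)).
  rewrite ler_wpM2l// addrAC lerDl mulr_ge0 ?sqrtr_ge0//.
  exact: sqr_ge0.
move=> V P pi p Gam cardV hyp _ S s lim0 t _.
apply/cvgrPdist_le => e e0.
(* 48 = 12 * 4, with the 12 of [opinion_mean_kolmogorov] and the 4 of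
   [fluctuation_term_le]. *)
have e48 : 0 < e / 48 by rewrite divr_gt0.
near=> k.
have k1 : (1 <= k)%N by near: k; exists 1%N.
have [hP _ hpi p01 hG] := hyp k k1.
have := opinion_mean_kolmogorov hP hpi p01 hG t.
have := fluctuation_term_le hP hpi p01 hG.
have : `|0 - (k%:R / p k * (pi_star (pi k) / s k) ^+ 3
                 + pi_star (pi k) / (s k * p k))| <= e / 48.
  by near: k; apply: cvgr_dist_le.
rewrite sub0r normrN distrC (cardV k k1) => H1 H2 H3.
rewrite (expect_opinion_mean hP hpi p01 hG).
apply: (le_trans H3); have := ler_norm (k%:R / p k * (pi_star (pi k) / s k) ^+ 3
                 + pi_star (pi k) / (s k * p k)).
rewrite -/(s k) in H2 *.
have : 0 <= k%:R / p k * (pi_star (pi k) / s k) ^+ 3.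
  case/andP: p01 => p0 _; rewrite mulr_ge0 ?divr_ge0 ?(ltW p0)//.
  by rewrite exprn_ge0// divr_ge0 ?pi_star_ge0// sqrtr_ge0.
lra.
Unshelve. all: by end_near. Qed.
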